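(* Let $r$ be continuous, let $f$ be a nontrivial real solution of $f''(x)+r(x)f(x)=0$, let $z_{f'_1}<z_{f'_2}$ be two consecutive zeros of $f'$, let $\mathcal{I}=(z_{f'_1},z_{f'_2})$, and let $z_{f_1}$ be the unique zero of $f$ in $\mathcal{I}$. Put $h=f/f'$ on $\mathcal I$. Let $k_1,k_2$ be positive constants such that $\frac{k_2^3}{k_1^2}>\frac16$ and $r(x)>k_2$ for all $x\in\mathcal I$. For an initial guess $x_0\in\mathcal I$ consider Halley's iteration $$x_{n+1}=x_n-\frac{2h(x_n)}{2+r(x_n)h^2(x_n)},\qquad n=0,1,2,\dots$$ (1) If $r$ is differentiable with $0\le r'(x)<k_1$ in $(z_{f'_1},z_{f_1})$, then for every initial guess $x_0\in(z_{f'_1},z_{f_1})$ the sequence $(x_n)$ is well defined and converges monotonically to $z_{f_1}$. (2) If $r$ is differentiable with $-k_1<r'(x)\le 0$ in $(z_{f_1},z_{f'_2})$, then for every initial guess $x_0\in(z_{f_1},z_{f'_2})$ the sequence $(x_n)$ is well defined and converges monotonically to $z_{f_1}$.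
   Context: All functions are real-valued; $r$ is continuous on an open interval $D\subseteq\mathbb{R}$ containing all points mentioned, and $f$ is a not identically zero solution on $D$ of $f''+rf=0$. It is a standing assumption that $f$ has exactly one zero $z_{f_1}$ in $\mathcal I=(z_{f'_1},z_{f'_2})$. Since $f'$ has no zeros in $\mathcal I$, the function $h=f/f'$ is defined on $\mathcal I$. ''Converges monotonically'' means that the sequence is monotone and converges. *)

(* Defs.v *)
From Stdlib Require Export Reals.
From Coquelicot Require Export Coquelicot.

Open Scope R_scope.

(* A nonempty open interval of the real line, possibly unbounded. *)
Definition open_interval (D : R -> Prop) : Prop :=
  exists a b : Rbar, Rbar_lt a b /\
    forall x : R, D x <-> (Rbar_lt a x /\ Rbar_lt x b).

(* [Derive] is total, so both orders of differentiability are required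
   explicitly. *)
Definition ode_solution (D : R -> Prop) (r f : R -> R) : Prop :=
  forall x : R, D x ->
    ex_derive f x /\ ex_derive (Derive f) x /\
    Derive_n f 2 x + r x * f x = 0.

Definition nontrivial_on (D : R -> Prop) (f : R -> R) : Prop :=
  exists x : R, D x /\ f x <> 0.

Definition consecutive_zeros (g : R -> R) (a b : R) : Prop :=
  a < b /\ g a = 0 /\ g b = 0 /\ forall x : R, a < x < b -> g x <> 0.

Definition unique_zero_in (g : R -> R) (a b z : R) : Prop :=
  a < z < b /\ g z = 0 /\ forall x : R, a < x < b -> g x = 0 -> x = z.

Definition hfun (f : R -> R) (x : R) : R := f x / Derive f x.

Definition halley_denom (r f : R -> R) (x : R) : R :=
  2 + r x * (hfun f x) ^ 2.

Fixpoint halley (r f : R -> R) (x0 : R) (n : nat) : R :=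
  match n with
  | O => x0
  | S m => let x := halley r f x0 m in
           x - 2 * hfun f x / halley_denom r f x
  end.

(* [halley] is total because [Rdiv] is. The iteration is meaningful when every
   iterate lies in the interval (a, b) on which h = f / f' is defined and no
   denominator vanishes. *)
Definition halley_well_defined (r f : R -> R) (a b x0 : R) : Prop :=
  forall n : nat, a < halley r f x0 n < b /\
    halley_denom r f (halley r f x0 n) <> 0.

Definition converges_monotonically (u : nat -> R) (l : R) : Prop :=
  ((forall n : nat, u n <= u (S n)) \/ (forall n : nat, u (S n) <= u n)) /\
  is_lim_seq u (Finite l).

(* Main.v *)
(** With [s = r h^2], the function [h = f / f'] satisfies [h' = 1 + s], and the
    Halley map [g] has derivative [(2 s + 3 s^2 + 2 r' h^3) / (2 + s)^2].  When
    [|r'| <= k1] and [r > k2], this is nonnegative because the quadratic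
    [3 k2^2 y^2 - 2 k1 y + 2 k2] has negative discriminant exactly when
    [k2^3 / k1^2 > 1/6].  Hence [g] cannot jump over its fixed point [z], while
    the sign of [h] makes it move towards [z]; the iterates are monotone and
    bounded, and their limit is a fixed point of [g], i.e. a zero of [f]. *)
Require Import Defs.
From Stdlib Require Import Lra.

(** The iterates never pass [z], so they increase to some limit [l <= z]; by continuity [l] is a
    fixed point of [g], and the only one available is [z]. *)
Lemma increasing_iteration_cv (g : R -> R) (u : nat -> R) (a z : R) :
  (forall n, u (S n) = g (u n)) ->
  a < u O <= z ->
  (forall x, a < x <= z -> x <= g x <= z) ->
  (forall x, a < x <= z -> continuous g x) ->
  (forall x, a < x <= z -> g x = x -> x = z) ->
  (forall n, a < u n <= z) /\ (forall n, u n <= u (S n)) /\ is_lim_seq u z.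
Proof.
intros Hu H0 Hg Hc Hfix.
assert (Hin : forall n, a < u n <= z).
{ induction n as [|n IH]; [exact H0|].
  rewrite Hu; specialize (Hg _ IH); lra. }
assert (Hincr : forall n, u n <= u (S n)).
{ intros n; rewrite Hu; apply Hg, Hin. }
split; [exact Hin|split; [exact Hincr|]].
destruct (ex_finite_lim_seq_incr u z Hincr (fun n => proj2 (Hin n))) as [l Hl].
(* The first term keeps the limit away from the excluded end [a], where nothing is known about
   [g]. *)
assert (Hl0 : u O <= l) by (apply (is_lim_seq_incr_compare u l Hl Hincr)).
assert (Hlz : l <= z).
{ apply (is_lim_seq_le u (fun _ => z) l z); [apply Hin|exact Hl|].
  apply is_lim_seq_const. }
assert (Hlin : a < l <= z) by lra.
assert (Hgl : is_lim_seq (fun n => g (u n)) (g l)).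
{ apply is_lim_seq_continuous; [|exact Hl].
  apply continuity_pt_filterlim, Hc, Hlin. }
assert (Hul : is_lim_seq (fun n => g (u n)) l).
{ apply is_lim_seq_ext with (fun n => u (S n)); [exact Hu|].
  now apply -> is_lim_seq_incr_1. }
apply is_lim_seq_unique in Hgl; apply is_lim_seq_unique in Hul.
rewrite Hgl in Hul; injection Hul as Heq.
now rewrite <- (Hfix l Hlin Heq).
Qed.

(** Mirror image of the increasing case, by conjugating [g] with x -> -x. *)
Lemma decreasing_iteration_cv (g : R -> R) (u : nat -> R) (z b : R) :
  (forall n, u (S n) = g (u n)) ->
  z <= u O < b ->
  (forall x, z <= x < b -> z <= g x <= x) ->
  (forall x, z <= x < b -> continuous g x) ->
  (forall x, z <= x < b -> g x = x -> x = z) ->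
  (forall n, z <= u n < b) /\ (forall n, u (S n) <= u n) /\ is_lim_seq u z.
Proof.
intros Hu H0 Hg Hc Hfix.
destruct (increasing_iteration_cv (fun x => - g (- x)) (fun n => - u n) (- b) (- z))
  as (Hin & Hincr & Hlim).
- intros n; now rewrite Ropp_involutive, Hu.
- lra.
- intros x Hx; assert (H := Hg (- x)); lra.
- intros x Hx; apply (continuous_opp (V := R_NormedModule) (fun y => g (- y))).
  apply (continuous_comp Ropp g).
  + apply (continuous_opp (V := R_NormedModule) (fun y => y)), continuous_id.
  + apply Hc; lra.
- intros x Hx Hgx; assert (H := Hfix (- x)); lra.
- split; [intros n; specialize (Hin n); lra|].
  split; [intros n; specialize (Hincr n); simpl in Hincr; lra|].
  apply is_lim_seq_opp in Hlim; simpl in Hlim; rewrite Ropp_involutive in Hlim.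
  revert Hlim; apply is_lim_seq_ext; intros n; apply Ropp_involutive.
Qed.

(** The body repeats the successor clause of [halley], so the recurrence holds by conversion. *)
Definition halley_step (r f : R -> R) (x : R) : R :=
  x - 2 * hfun f x / halley_denom r f x.

Lemma halley_denom_pos (r f : R -> R) (x : R) :
  0 <= r x -> 0 < halley_denom r f x.
Proof.
intros Hr; unfold halley_denom; assert (H := pow2_ge_0 (hfun f x)); nra.
Qed.

(** Quotient rule with f'' = -r f: the linear equation becomes the Riccati equation of [h]. *)
Lemma is_derive_hfun (D : R -> Prop) (r f : R -> R) (x : R) :
  ode_solution D r f -> D x -> Derive f x <> 0 ->
  is_derive (hfun f) x (1 + r x * hfun f x ^ 2).
Proof.
intros Hode Hx Hne; destruct (Hode x Hx) as (Hf & Hf' & Heq).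
assert (Heq' : Derive (Derive f) x = - (r x * f x)) by (change (Derive (Derive f) x + r x * f x = 0) in Heq; lra).
apply Derive_correct in Hf; apply Derive_correct in Hf'.
assert (H := is_derive_div f (Derive f) x _ _ Hf Hf' Hne).
rewrite Heq' in H; unfold hfun.
replace (1 + r x * (f x / Derive f x) ^ 2)
  with ((Derive f x * Derive f x - f x * - (r x * f x)) / Derive f x ^ 2)
  by (field; exact Hne).
exact H.
Qed.

(** Asks only continuity of [r], since at the zero of [f] itself [r] is not assumed
    differentiable. *)
Lemma continuous_halley_step (r f : R -> R) (x : R) :
  continuous r x -> continuous (hfun f) x -> halley_denom r f x <> 0 ->
  continuous (halley_step r f) x.
Proof.
intros Hr Hh Hd.
apply continuity_pt_filterlim in Hr; apply continuity_pt_filterlim in Hh.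
apply continuity_pt_filterlim; unfold halley_step.
apply continuity_pt_minus; [apply continuity_pt_id|].
apply continuity_pt_div; [|unfold halley_denom|exact Hd].
- apply continuity_pt_mult; [apply continuity_pt_const; now intros ? ?|exact Hh].
- apply continuity_pt_plus; [apply continuity_pt_const; now intros ? ?|].
  apply continuity_pt_mult; [exact Hr|].
  apply (continuity_pt_comp (hfun f) (fun y => y ^ 2)); [exact Hh|].
  apply derivable_continuous_pt, derivable_pt_pow.
Qed.

(** With h' = 1 + s one has h s' = r' h^3 + 2 s (1 + s); the terms of order zero then cancel in the
    numerator. *)
Lemma is_derive_halley_step (r f : R -> R) (x : R) :
  let h := hfun f x in let s := r x * h ^ 2 in
  ex_derive r x -> is_derive (hfun f) x (1 + s) -> 2 + s <> 0 ->
  is_derive (halley_step r f) x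
    ((2 * s + 3 * s ^ 2 + 2 * Derive r x * h ^ 3) / (2 + s) ^ 2).
Proof.
intros h s Hr Hh Hs; unfold halley_step, halley_denom.
auto_derive.
- repeat split; auto; exists (1 + s); exact Hh.
- replace (Derive _ x) with (1 + s) by (symmetry; exact (is_derive_unique _ _ _ Hh)).
  fold h; change (Derive (fun y => r y) x) with (Derive r x).
  unfold s in *; field; exact Hs.
Qed.

(** Factoring out h^2 leaves a quadratic in [h] of discriminant 4 (dr^2 - 6 r^3), negative because
    dr^2 <= k1^2 < 6 k2^3 <= 6 r^3. *)
Lemma halley_numerator_nonneg (k1 k2 r dr h : R) :
  0 < k1 -> 0 < k2 -> k2 ^ 3 / k1 ^ 2 > 1 / 6 -> k2 < r -> Rabs dr <= k1 ->
  0 <= 2 * (r * h ^ 2) + 3 * (r * h ^ 2) ^ 2 + 2 * dr * h ^ 3.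
Proof.
intros Hk1 Hk2 Hk Hr Hdr.
assert (Hdisc : k1 ^ 2 < 6 * k2 ^ 3).
{ assert (Hk1' : 0 < k1 ^ 2) by nra.
  assert (H := Rmult_gt_compat_r _ _ _ Hk1' Hk).
  replace (k2 ^ 3 / k1 ^ 2 * k1 ^ 2) with (k2 ^ 3) in H by (field; lra).
  lra. }
assert (Hdr2 : dr ^ 2 <= k1 ^ 2).
{ now apply pow_maj_Rabs. }
assert (Hr3 : k2 ^ 3 <= r ^ 3) by (apply pow_incr; lra).
(* Completing the square in [h], scaled by [3 r^2]. *)
assert (Hq : 0 <= 2 * r + 2 * dr * h + 3 * r ^ 2 * h ^ 2).
{ apply Rmult_le_reg_l with (3 * r ^ 2); [nra|].
  rewrite Rmult_0_r.
  replace (3 * r ^ 2 * (2 * r + 2 * dr * h + 3 * r ^ 2 * h ^ 2))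
    with ((3 * r ^ 2 * h + dr) ^ 2 + (6 * r ^ 3 - dr ^ 2)) by ring.
  assert (H := pow2_ge_0 (3 * r ^ 2 * h + dr)); lra. }
replace (_ + _) with (h ^ 2 * (2 * r + 2 * dr * h + 3 * r ^ 2 * h ^ 2)) by ring.
apply Rmult_le_pos; [apply pow2_ge_0|exact Hq].
Qed.

Lemma open_interval_convex (D : R -> Prop) (a b x : R) :
  open_interval D -> D a -> D b -> a <= x <= b -> D x.
Proof.
intros (p & q & _ & HD) Ha Hb Hx.
apply HD in Ha; apply HD in Hb; apply HD; split.
- apply Rbar_lt_le_trans with (Finite a); [apply Ha|apply Hx].
- apply Rbar_le_lt_trans with (Finite b); [apply Hx|apply Hb].
Qed.

(** Mean value theorem for unordered endpoints, so that one statement serves both sides of the zero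
    of [f]. *)
Lemma nonneg_derive_slope (g : R -> R) (x y : R) :
  (forall t, Rmin x y < t < Rmax x y -> exists d, 0 <= d /\ is_derive g t d) ->
  (forall t, Rmin x y <= t <= Rmax x y -> continuous g t) ->
  exists c, 0 <= c /\ g y - g x = c * (y - x).
Proof.
intros Hd Hc.
(* [Rmax 0] because [MVT_gen] may return an endpoint, where [Derive g] is
   not controlled. *)
destruct (MVT_gen g x y (fun t => Rmax 0 (Derive g t))) as (c & _ & Heq).
- intros t Ht; destruct (Hd t Ht) as (d & Hd0 & Hdt).
  now rewrite (is_derive_unique _ _ _ Hdt), Rmax_right.
- intros t Ht; apply continuity_pt_filterlim, Hc, Ht.
- exists (Rmax 0 (Derive g c)); split; [apply Rmax_l|exact Heq].
Qed.

Theorem theorem3p7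
  (D : R -> Prop) (r f : R -> R) (zf'1 zf'2 zf1 k1 k2 : R)
  (hD : open_interval D)
  (hr : forall x : R, D x -> continuous r x)
  (hf : ode_solution D r f)
  (hf0 : nontrivial_on D f)
  (hD1 : D zf'1) (hD2 : D zf'2)
  (hz' : consecutive_zeros (Derive f) zf'1 zf'2)
  (hz : unique_zero_in f zf'1 zf'2 zf1)
  (hk1 : 0 < k1) (hk2 : 0 < k2)
  (hk : k2 ^ 3 / k1 ^ 2 > 1 / 6)
  (hrk : forall x : R, zf'1 < x < zf'2 -> r x > k2) :
  ((forall x : R, zf'1 < x < zf1 -> ex_derive r x /\ 0 <= Derive r x < k1) ->
   forall x0 : R, zf'1 < x0 < zf1 ->
     halley_well_defined r f zf'1 zf'2 x0 /\
     converges_monotonically (halley r f x0) zf1)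
  /\
  ((forall x : R, zf1 < x < zf'2 -> ex_derive r x /\ - k1 < Derive r x <= 0) ->
   forall x0 : R, zf1 < x0 < zf'2 ->
     halley_well_defined r f zf'1 zf'2 x0 /\
     converges_monotonically (halley r f x0) zf1).
Proof.
destruct hz' as (Hlt & _ & _ & Hf'ne).
destruct hz as (Hz & Hfz & Huniq).
set (g := halley_step r f).
assert (HD : forall x, zf'1 < x < zf'2 -> D x).
{ intros x Hx; apply (open_interval_convex D zf'1 zf'2); auto; lra. }
assert (Hdh : forall x, zf'1 < x < zf'2 ->
  is_derive (hfun f) x (1 + r x * hfun f x ^ 2)).
{ intros x Hx; apply is_derive_hfun with D; auto. }
assert (Hch : forall x, zf'1 < x < zf'2 -> continuous (hfun f) x).
{ intros x Hx; apply (ex_derive_continuous (hfun f)).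
  eexists; apply Hdh, Hx. }
assert (Hden : forall x, zf'1 < x < zf'2 -> 0 < halley_denom r f x).
{ intros x Hx; apply halley_denom_pos; specialize (hrk x Hx); lra. }
assert (Hcg : forall x, zf'1 < x < zf'2 -> continuous g x).
{ intros x Hx; apply continuous_halley_step; auto.
  specialize (Hden x Hx); lra. }
assert (Hhz : hfun f zf1 = 0) by (unfold hfun; rewrite Hfz; apply Rmult_0_l).
assert (Hgz : g zf1 = zf1).
{ unfold g, halley_step; rewrite Hhz; unfold Rdiv; ring. }
assert (Hbtw : forall x, zf'1 < x < zf'2 -> forall t,
  Rmin x zf1 <= t <= Rmax x zf1 -> zf'1 < t < zf'2).
{ intros x Hx t; unfold Rmin, Rmax; destruct (Rle_dec x zf1); lra. }
(* [h] vanishes at [zf1] and h' = 1 + s > 0, which fixes its sign on each side. *)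
assert (Hsign : forall x, zf'1 < x < zf'2 ->
  exists c, 0 <= c /\ hfun f x = c * (x - zf1)).
{ intros x Hx.
  destruct (nonneg_derive_slope (hfun f) x zf1) as (c & Hc & Heq).
  - intros t Ht; assert (Ht' : zf'1 < t < zf'2) by (apply (Hbtw x); lra).
    exists (1 + r t * hfun f t ^ 2); split; [|now apply Hdh].
    specialize (Hden t Ht'); specialize (hrk t Ht').
    assert (H := pow2_ge_0 (hfun f t)); nra.
  - intros t Ht; apply Hch, (Hbtw x); auto.
  - exists c; split; [exact Hc|]; rewrite Hhz in Heq; lra. }
(* Since 2 + s > 0, the sign of [h] directs each step towards [zf1]. *)
assert (Hmove : forall x, zf'1 < x < zf'2 ->
  exists c, 0 <= c /\ g x - x = c * (zf1 - x)).
{ intros x Hx; destruct (Hsign x Hx) as (c & Hc & Heq).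
  specialize (Hden x Hx).
  exists (2 * c / halley_denom r f x); split.
  - apply Rmult_le_pos; [lra|apply Rlt_le, Rinv_0_lt_compat, Hden].
  - unfold g, halley_step; rewrite Heq; field; lra. }
(* As [zf1] is fixed by [g] and g' >= 0 between [x] and [zf1], the image of [x] stays on its
   side. *)
assert (Hnojump : forall x, zf'1 < x < zf'2 ->
  (forall t, Rmin x zf1 < t < Rmax x zf1 ->
     ex_derive r t /\ - k1 <= Derive r t <= k1) ->
  exists c, 0 <= c /\ zf1 - g x = c * (zf1 - x)).
{ intros x Hx Hr'.
  destruct (nonneg_derive_slope g x zf1) as (c & Hc & Heq).
  - intros t Ht; assert (Ht' : zf'1 < t < zf'2) by (apply (Hbtw x); lra).
    destruct (Hr' t Ht) as (Hrt & Hbd).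
    assert (Hd := Hden t Ht'); unfold halley_denom in Hd.
    eexists; split; [|apply is_derive_halley_step; auto; lra].
    apply Rmult_le_pos.
    + apply halley_numerator_nonneg with k1 k2; auto.
      * now apply hrk.
      * now apply Rabs_le.
    + apply Rlt_le, Rinv_0_lt_compat, pow_lt, Hd.
  - intros t Ht; apply Hcg, (Hbtw x); auto.
  - exists c; split; [exact Hc|]; lra. }
assert (Hfix : forall x, zf'1 < x < zf'2 -> g x = x -> x = zf1).
{ intros x Hx Hgx; apply Huniq; [exact Hx|].
  specialize (Hden x Hx); specialize (Hf'ne x Hx).
  unfold g, halley_step in Hgx.
  assert (Hh : 2 * hfun f x / halley_denom r f x = 0) by lra.
  (* Multiplying the vanishing step 2 h / (2 + s) by (2 + s) f' / 2 gives back [f x]. *)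
  replace (f x) with (2 * hfun f x / halley_denom r f x
    * (halley_denom r f x * Derive f x / 2)).
  - rewrite Hh; ring.
  - unfold hfun at 1; field; lra. }
split; intros Hr' x0 Hx0.
- destruct (increasing_iteration_cv g (halley r f x0) zf'1 zf1)
    as (Hin & Hincr & Hlim).
  + reflexivity.
  + simpl; lra.
  + intros x Hx; assert (Hx' : zf'1 < x < zf'2) by lra.
    destruct (Hmove x Hx') as (c & Hc & Heq).
    destruct (Hnojump x Hx') as (d & Hd & Heq').
    (* For [x = zf1] the range of [t] is empty, so the bound on r' is called upon only strictly left
       of [zf1]. *)
    { intros t; rewrite Rmin_left, Rmax_right by lra; intros Ht.
      destruct (Hr' t) as (Hrt & Hbd); [lra|split; [exact Hrt|lra]]. }
    split; nra.
  + intros x Hx; apply Hcg; lra.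
  + intros x Hx; apply Hfix; lra.
  + split; [|now split; [left|]].
    intros n; assert (Hn : zf'1 < halley r f x0 n < zf'2)
      by (specialize (Hin n); lra).
    split; [exact Hn|specialize (Hden _ Hn); lra].
- destruct (decreasing_iteration_cv g (halley r f x0) zf1 zf'2)
    as (Hin & Hdecr & Hlim).
  + reflexivity.
  + simpl; lra.
  + intros x Hx; assert (Hx' : zf'1 < x < zf'2) by lra.
    destruct (Hmove x Hx') as (c & Hc & Heq).
    destruct (Hnojump x Hx') as (d & Hd & Heq').
    { intros t; rewrite Rmin_right, Rmax_left by lra; intros Ht.
      destruct (Hr' t) as (Hrt & Hbd); [lra|split; [exact Hrt|lra]]. }
    (* Now [zf1 - x <= 0], so the same two factorizations give [zf1 <= g x <= x]. *)
    split; nra.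
  + intros x Hx; apply Hcg; lra.
  + intros x Hx; apply Hfix; lra.
  + split; [|now split; [right|]].
    intros n; assert (Hn : zf'1 < halley r f x0 n < zf'2)
      by (specialize (Hin n); lra).
    split; [exact Hn|specialize (Hden _ Hn); lra].
Qed.
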